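(* Let $G=(V,E)$ be a countably infinite simple undirected graph in which every vertex has finite degree, with clique-degree $D$, and let $\mathcal{G}$ be an integral generalized graphical potential game on $G$ with $M$-bounded local potentials. Then the number of times that a player $k\in V$ updates her strategy in any better-response path is at most $$2DM\sum_{r=0}^{\infty}\left(1-\frac{1}{2DM}\right)^r S_r(G,k).$$
   Context: A game has player set $V$; each player $i\in V$ has a finite strategy set $\mathcal{S}_i$; $\mathcal{S}=\prod_{i\in V}\mathcal{S}_i$ is the set of strategy profiles; player $i$ has a utility $u_i\colon\mathcal{S}\to\mathbb{R}$. It is a graphical game on $G$ if each $u_i(a)$ depends only on the strategies of $i$ and of the neighbors of $i$ in $G$. Two games with utilities $u$ and $w$ on the same $\mathcal{S}$ are strategically equivalent if for each $i$ there is a function $f_i\colon\prod_{j\ne i}\mathcal{S}_j\to\mathbb{R}$ with $u_i(a)=w_i(a)+f_i(a_{-i})$ for all $a\in\mathcal{S}$, where $a_{-i}=(a_j)_{j\neq i}$. $\mathcal{C}(G)$ is the set of maximal cliques of $G$ (cliques not contained in strictly larger cliques). For $C\subseteq V$, $a^C$ is the restriction of $a\in\mathcal{S}$ to $C$. A graphical game on $G$ is a generalized graphical potential game if it is strategically equivalent to a game with utilities $w_i(a)=\sum_{C\in\mathcal{C}(G):\,i\in C}\Phi^C(a^C)$ for some local potentials $\Phi^C\colon\prod_{i\in C}\mathcal{S}_i\to\mathbb{R}$, $C\in\mathcal{C}(G)$. It has $M$-bounded local potentials if $|\Phi^C(a^C)|\le M$ for all $C$ and $a^C$, and it is integral if all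 these local potentials take only integer values. The clique-degree of $G$ is the largest number of maximal cliques that any vertex of $G$ participates in (for an infinite graph it may diverge). A better-response path is a finite or infinite sequence of profiles $a(0),a(1),\dots$ such that for each consecutive pair, $a(t+1)$ differs from $a(t)$ in exactly one coordinate $i=i(t)$ and $u_{i}(a(t+1))>u_{i}(a(t))$; player $i(t)$ is said to update her strategy at time $t$. $S_r(G,k)$ is the number of vertices at graph distance exactly $r$ from $k$ in $G$. The bound may be infinite, in which case the statement is vacuous.
   Formalization: It is additionally assumed that M = 0 or 2DM ≥ 1: for 0 < M < 1/(2D) the bound can be negative (zero game on infinitely many disjoint edges, D = 1, M = 1/10) while no player updates; for M = 0 the bound is read as 0. *)

(* Defs.v *)
From HB Require Import structures.
From mathcomp Require Import all_boot all_order all_algebra.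
From mathcomp Require Import all_classical all_reals all_analysis.
Import Order.TTheory GRing.Theory Num.Theory.

Set Implicit Arguments.
Unset Strict Implicit.
Unset Printing Implicit Defensive.

Local Open Scope classical_set_scope.
Local Open Scope ring_scope.

(** All cardinalities are measured in [\bar R] by the library's [counting], so
    that an infinite set counts as [+oo]. A graph on [V] is given by its
    adjacency relation [E], assumed symmetric and irreflexive in theorems. *)

Section Graphs.
Variables (V : countType) (E : rel V).

Definition locally_finite := forall i : V, finite_set [set j | E i j].

Definition clique (C : set V) := forall i j, C i -> C j -> i != j -> E i j.

Definition maximal_clique (C : set V) :=
  clique C /\ forall B, clique B -> ~ (C `<` B).

Definition cliques_at (i : V) : set (set V) :=
  [set C | maximal_clique C /\ C i].

Definition clique_degree (R : realType) : \bar R :=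
  ereal_sup [set counting (cliques_at i) | i in [set: V]].

(** [p] lists the vertices of a walk from [k] after [k] itself, so [size p] is
    the number of edges. *)
Definition walk (k j : V) (p : seq V) := path E k p /\ last k p = j.

Definition sphere (k : V) (r : nat) : set V :=
  [set j | (exists p, walk k j p /\ size p = r) /\
           forall p, walk k j p -> (r <= size p)%N].

End Graphs.

Section Games.
Variables (V : countType) (S : V -> finType) (R : realType).

Definition profile := forall i : V, S i.

Definition partial_profile (C : set V) := forall i : C, S (val i).

Definition restriction (C : set V) (a : profile) : partial_profile C :=
  fun i => a (val i).
Arguments restriction C a : clear implicits.

Definition utilities := V -> profile -> R.

Definition graphical_game (E : rel V) (u : utilities) :=
  forall i (a b : profile),
    (forall j, j = i \/ E i j -> a j = b j) -> u i a = u i b.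

Definition strategically_equivalent (u w : utilities) :=
  exists f : forall i : V, partial_profile (~` [set i]) -> R,
    forall i a, u i a = w i a + f i (restriction (~` [set i]) a).

(** Only the values at maximal cliques are ever used. *)
Definition local_potentials := forall C : set V, partial_profile C -> R.

(** The sum is over a finite set when [E] is locally finite. *)
Definition clique_utilities (E : rel V) (Phi : local_potentials) : utilities :=
  fun i a => \sum_(C \in cliques_at E i) Phi C (restriction C a).

Definition generalized_potential_game
    (E : rel V) (u : utilities) (Phi : local_potentials) :=
  graphical_game E u /\ strategically_equivalent u (clique_utilities E Phi).

Definition bounded_potentials (E : rel V) (M : R) (Phi : local_potentials) :=
  forall C, maximal_clique E C -> forall x : partial_profile C,
    `|Phi C x| <= M.

Definition integral_potentials (E : rel V) (Phi : local_potentials) :=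
  forall C, maximal_clique E C -> forall x : partial_profile C,
    Phi C x \is a Num.int.

Definition better_response (u : utilities) (i : V) (a b : profile) :=
  [/\ b i <> a i, (forall j, j != i -> b j = a j) & u i a < u i b].

(** A path with [T = Some n] has [n] steps, through the profiles
    [a 0, ..., a n] (later values of [a] are irrelevant); [T = None] is an infinite path. *)
Definition is_step (T : option nat) (t : nat) : bool :=
  if T is Some n then (t < n)%N else true.

Definition better_response_path
    (u : utilities) (T : option nat) (a : nat -> profile) :=
  forall t, is_step T t -> exists i, better_response u i (a t) (a t.+1).

Definition update_times
    (u : utilities) (T : option nat) (a : nat -> profile) (k : V) : set nat :=
  [set t | is_step T t /\ better_response u k (a t) (a t.+1)].

End Games.

(* Main.v *)
(** Put [q = 1 - 1/(2DM)], give each vertex [j] the weight [x j = q ^ dist(k, j)]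
    ([0] if [j] is unreachable), and each maximal clique [C] the weight [y C] of
    its heaviest vertex. The weighted potential [sum_C y C * Phi C] never
    decreases along a better-response path: if [i] moves and [m] is the largest
    weight in the closed neighbourhood of [i], then the cliques at [i] have
    weights in [[q m, m]] and gains [g_C <= 2M] whose sum is at least [1] by
    integrality, so [sum_C y C g_C >= m (1 - D (1 - q) 2M) = 0]. When [k] moves
    all these weights are [1] and the potential gains at least [1]. Over
    any finite prefix only finitely many cliques [C] matter, and their total
    gain is at most [2M sum_C y C <= 2DM sum_j x j], since every vertex is
    the heaviest one of at most [D] cliques. *)

Require Import Defs.
From mathcomp Require Import all_boot all_order all_algebra.
From mathcomp Require Import all_classical all_reals all_analysis.
From mathcomp Require Import lra.
Import Order.TTheory GRing.Theory Num.Theory.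

Set Implicit Arguments.
Unset Strict Implicit.
Unset Printing Implicit Defensive.

Local Open Scope classical_set_scope.
Local Open Scope ereal_scope.

(** * Counting through finite lists *)

Lemma size_le_counting (T : choiceType) (R : realType) (A : set T) (s : seq T) :
  uniq s -> (forall x, x \in s -> A x) -> (size s)%:R%:E <= counting A :> \bar R.
Proof.
move=> us sA; rewrite /counting; case: asboolP => Af; last exact: leey.
rewrite lee_fin ler_nat; apply: uniq_leq_size => // x xs.
by rewrite in_fset_set // inE; apply: sA.
Qed.

(** Reduces a possibly infinite count to finite lists. An infinite [A] contains arbitrarily long
    ones, so [B] lies above every natural number and must be [+oo]. *)
Lemma counting_le (T : choiceType) (R : realType) (A : set T) (B : \bar R) :
  (forall s : seq T, uniq s -> (forall x, x \in s -> A x) ->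
     (size s)%:R%:E <= B) ->
  counting A <= B.
Proof.
move=> sB; rewrite /counting; case: asboolP => Af.
  apply: sB; first exact: finmap.fset_uniq.
  by move=> x; rewrite in_fset_set // inE.
have nB n : n%:R%:E <= B.
  have [X XA nX] := infinite_set_fset n Af.
  have := sB (finmap.enum_fset X) (finmap.fset_uniq X) XA.
  by apply: le_trans; rewrite lee_fin ler_nat.
case: B nB {sB} => [b| |] nB //.
  have := nB (Num.truncn b).+1; rewrite lee_fin => /(lt_le_trans (truncnS_gt b)).
  by rewrite ltxx.
by have := nB 0%N.
Qed.

Local Open Scope ring_scope.

(** * Finite maxima and sums *)

Lemma finite_argmax (T : choiceType) (R : realType) (x : T -> R) (A : set T) :
  finite_set A -> A !=set0 ->
  exists2 i, A i & forall j, A j -> x j <= x i.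
Proof.
move=> /finite_seqP[s ->]; elim: s => [|i s IH] /= s0; first by case: s0.
have [->|sN] := eqVneq s [::].
  by exists i; rewrite /= ?inE // => j; rewrite inE => /eqP ->.
have /IH[m ms mmax] : [set` s] !=set0.
  by case: s sN {s0 IH} => // a s _; exists a; rewrite /= inE eqxx.
have [le|/ltW le] := leP (x i) (x m).
  exists m; first by rewrite /= inE [m \in s]ms orbT.
  by move=> j; rewrite /= inE => /predU1P[->//|]; apply: mmax.
exists i; first by rewrite /= inE eqxx.
move=> j; rewrite /= inE => /predU1P[->//|js].
exact: le_trans (mmax _ js) le.
Qed.

(** Replacing [y i] by [m] changes a term by [(m - y i) * g i], at most [(1 - q) * m * B] whatever
    the sign of [g i]. These losses add up to at most [m], while the sum with constant weight [m] is
    at least [m]. *)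
Lemma weighted_gain_ge0 (R : realType) (I : eqType) (s : seq I) (y g : I -> R)
    (m q B : R) :
  0 <= m -> 0 <= B -> q <= 1 -> (size s)%:R * B * (1 - q) <= 1 ->
  (forall i, i \in s -> q * m <= y i <= m) -> (forall i, i \in s -> g i <= B) ->
  1 <= \sum_(i <- s) g i -> 0 <= \sum_(i <- s) y i * g i.
Proof.
move=> m0 B0 q1 sB ym gB g1.
have step i : i \in s -> m * g i - y i * g i <= (1 - q) * m * B.
  move=> is_; have /andP[qy yle] := ym _ is_; have gi := gB _ is_.
  rewrite -mulrBl; apply: le_trans (_ : (m - y i) * B <= _).
    by apply: ler_wpM2l; rewrite ?subr_ge0.
  by apply: ler_wpM2r => //; lra.
have : \sum_(i <- s) (m * g i - y i * g i) <= (size s)%:R * ((1 - q) * m * B).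
  rewrite big_seq_cond; apply: le_trans (_ : \sum_(i <- s) (1 - q) * m * B <= _).
    rewrite [leRHS]big_seq_cond; apply: ler_sum => i; rewrite andbT; exact: step.
  by rewrite big_const_seq count_predT iter_addr addr0 mulr_natl.
rewrite big_split /= -mulr_sumr sumrN.
have : (size s)%:R * B * (1 - q) * m <= 1 * m by apply: ler_wpM2r.
have : m * 1 <= m * \sum_(i <- s) g i by apply: ler_wpM2l.
set G := \sum_(i <- s) g i; set Y := \sum_(i <- s) _; nra.
Qed.

(** Group the terms by the value of [f]: each [x j] then occurs at most [d] times. *)
Lemma sum_fibers_le (R : realType) (I J : eqType) (s : seq I) (f : I -> J)
    (x : J -> R) (d : R) :
  (forall j, 0 <= x j) ->
  (forall j, (count (fun i => f i == j) s)%:R <= d) ->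
  \sum_(i <- s) x (f i) <= d * \sum_(j <- undup (map f s)) x j.
Proof.
move=> x0 fd.
have -> : \sum_(i <- s) x (f i) =
    \sum_(i <- s) \sum_(j <- undup (map f s)) (f i == j)%:R * x j.
  apply: eq_big_seq => i is_.
  rewrite (bigD1_seq (f i)) ?undup_uniq ?mem_undup ?map_f //= eqxx mul1r.
  by rewrite big1 ?addr0 // => j /negPf; rewrite eq_sym => ->; rewrite mul0r.
rewrite exchange_big mulr_sumr; apply: ler_sum => j _.
rewrite -mulr_suml; apply: ler_wpM2r => //.
apply: le_trans (fd j); rewrite -sum1_count natr_sum [leRHS]big_mkcond /=.
by apply: ler_sum => i _; case: eqP.
Qed.

(** * Weights decaying with graph distance *)

Section DistanceWeight.
Variables (R : realType) (V : countType) (E : rel V) (k : V) (q : R).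
Hypotheses (Esym : symmetric E) (q0 : 0 <= q) (q1 : q <= 1).

Lemma sphere_exists j p : walk E k j p ->
  exists2 r, sphere E k r j & (r <= size p)%N.
Proof.
move=> kp; pose P r := `[< exists p, walk E k j p /\ size p = r >].
have exP : exists r, P r by exists (size p); apply/asboolP; exists p.
case: (ex_minnP exP) => r /asboolP[p' [kp' pr]] rmin; exists r.
  split; first by exists p'.
  by move=> p'' kp''; apply: rmin; apply/asboolP; exists p''.
by apply: rmin; apply/asboolP; exists p.
Qed.

Lemma sphere_inj j r s : sphere E k r j -> sphere E k s j -> r = s.
Proof.
move=> [[p [kp <-]] pmin] [[p' [kp' <-]] p'min].
by apply/eqP; rewrite eqn_leq pmin // p'min.
Qed.

Lemma sphere0 : sphere E k 0 k.
Proof. by split=> //; exists [::]; split. Qed.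

Definition distance_weight (j : V) : R :=
  if pselect (exists r, sphere E k r j) is left h then q ^+ (sval (cid h))
  else 0.

Lemma distance_weightE r j : sphere E k r j -> distance_weight j = q ^+ r.
Proof.
move=> jr; rewrite /distance_weight; case: pselect => [h|[]]; last by exists r.
by rewrite (sphere_inj (svalP (cid h)) jr).
Qed.

Lemma distance_weight_out j :
  ~ (exists r, sphere E k r j) -> distance_weight j = 0.
Proof. by rewrite /distance_weight; case: pselect. Qed.

Lemma distance_weight_ge0 j : 0 <= distance_weight j.
Proof. by rewrite /distance_weight; case: pselect => // h; exact: exprn_ge0. Qed.

Lemma distance_weight_le1 j : distance_weight j <= 1.
Proof. by rewrite /distance_weight; case: pselect => // h; exact: exprn_ile1. Qed.

Lemma distance_weight_center : distance_weight k = 1.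
Proof. by rewrite (distance_weightE sphere0). Qed.

(** Appending the edge to a shortest walk shows that the distance grows by at most one, and the
    powers of [q] are nonincreasing. An unreachable [i] has weight 0. *)
Lemma distance_weight_adj i j :
  E i j -> q * distance_weight i <= distance_weight j.
Proof.
move=> ij; have [[r ir]|iout] := pselect (exists r, sphere E k r i); last first.
  by rewrite distance_weight_out // mulr0 distance_weight_ge0.
have [[p [[kp pi] pr]] _] := ir.
have kj : walk E k j (rcons p j).
  by split; rewrite ?last_rcons // rcons_path kp pi.
have [s js] := sphere_exists kj; rewrite size_rcons pr => sr.
by rewrite (distance_weightE ir) (distance_weightE js) -exprS ler_wiXn2l.
Qed.

(** A finite list meets finitely many spheres; sorted by sphere, its vertices give at most
    [counting (sphere E k r)] terms [q ^+ r] for each [r]. *)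
Lemma sum_distance_weight_le (s : seq V) : uniq s ->
  ((\sum_(j <- s) distance_weight j)%:E <=
    \sum_(0 <= r <oo) (q ^+ r)%:E * counting (sphere E k r))%E.
Proof.
move=> us.
have terms_ge0 r : (0 <= (q ^+ r)%:E * counting (sphere E k r))%E.
  by apply: mule_ge0; rewrite ?lee_fin ?exprn_ge0 // (size_le_counting R (s := [::])).
(* [N] exceeds the distance from [k] of every reachable vertex of [s]. *)
have [N sN] : exists N, forall j r, j \in s -> sphere E k r j -> (r < N)%N.
  elim: s {us} => [|i s [N IH]]; first by exists 0%N.
  have [[r0 ir]|iout] := pselect (exists r, sphere E k r i).
    exists (maxn N r0.+1) => j r; rewrite inE => /predU1P[->|js] jr.
      by rewrite (sphere_inj jr ir) leq_maxr.
    by rewrite leq_max (IH _ _ js jr).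
  exists N => j r; rewrite inE => /predU1P[->|js] jr; last exact: IH jr.
  by case: iout; exists r.
apply: le_trans (@nneseries_lim_ge R _ xpredT 0 N _); last by move=> *.
have wE j : j \in s -> distance_weight j =
    \sum_(0 <= r < N) q ^+ r * (`[< sphere E k r j >])%:R.
  move=> js; have [[r0 jr]|jout] := pselect (exists r, sphere E k r j).
    rewrite (distance_weightE jr) (bigD1_seq r0) ?iota_uniq //=; last first.
      by rewrite mem_index_iota (sN j).
    have -> : `[< sphere E k r0 j >] by apply/asboolP.
    rewrite mulr1 big1 ?addr0 // => r rr0; case: asboolP => [jr'|]; last by rewrite mulr0.
    by rewrite (sphere_inj jr' jr) eqxx in rr0.
  rewrite distance_weight_out // big1 // => r _; case: asboolP => [jr|]; last by rewrite mulr0.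
  by case: jout; exists r.
rewrite (eq_big_seq _ wE) exchange_big -sumEFin; apply: lee_sum => r _ /=.
rewrite -mulr_sumr EFinM; apply: lee_wpmul2l; first by rewrite lee_fin exprn_ge0.
rewrite -natr_sum -big_mkcond /= sum1_count -size_filter; apply: size_le_counting.
  exact: filter_uniq.
by move=> j; rewrite mem_filter => /andP[/asboolP].
Qed.

End DistanceWeight.

(** * Gains of the local potentials *)

Section Dynamics.
Variables (R : realType) (V : countType) (E : rel V) (S : V -> finType).
Variables (u : utilities S R) (Phi : local_potentials S R) (M : R).
Hypotheses (Esym : symmetric E) (Elf : locally_finite E).
Hypothesis hgame : generalized_potential_game E u Phi.
Hypothesis hM : bounded_potentials E M Phi.
Hypothesis hint : integral_potentials E Phi.

Definition gain (a b : profile S) (C : set V) : R :=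
  Phi (restriction (C := C) b) - Phi (restriction (C := C) a).

Lemma restriction_eq (C : set V) (a b : profile S) :
  (forall j, C j -> b j = a j) ->
  restriction (C := C) b = restriction (C := C) a.
Proof.
move=> ba; apply: functional_extensionality_dep => j.
by rewrite /restriction ba //; apply: set_valP.
Qed.

Lemma gain_eq0 i a b C : better_response u i a b -> ~ C i -> gain a b C = 0.
Proof.
move=> [_ ba _] Ci; rewrite /gain (@restriction_eq C a b) ?subrr // => j Cj.
by apply: ba; apply/eqP => ji; rewrite ji in Cj.
Qed.

(** The term [f i] ignores the strategy of [i], the only one that the move changes, so it cancels in
    the difference. *)
Lemma better_response_utility_gain i a b : better_response u i a b ->
  0 < clique_utilities E Phi i b - clique_utilities E Phi i a.
Proof.
move=> [_ ba uab]; have [_ [f uf]] := hgame.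
move: uab; rewrite !uf (@restriction_eq (~` [set i]) a b) => [|j /eqP ji]; last exact: ba.
by rewrite ltrD2r subr_gt0.
Qed.

Definition cliques_seq (i : V) : seq (set V) :=
  finmap.enum_fset (fset_set (cliques_at E i)).

Lemma mem_cliques_seq i C : finite_set (cliques_at E i) ->
  C \in cliques_seq i <-> cliques_at E i C.
Proof. by move=> fin; rewrite in_fset_set // inE. Qed.

(** The sum is the change of the mover's clique utility: positive, and an integer because the
    potentials are integral. *)
Lemma total_gain_ge1 i a b : finite_set (cliques_at E i) ->
  better_response u i a b ->
  1 <= \sum_(C <- cliques_seq i) gain a b C.
Proof.
move=> fin /better_response_utility_gain.
rewrite /clique_utilities !fsbig_finite // -sumrB => gt0.
rewrite -(gtr0_norm gt0); apply: norm_intr_ge1; last by rewrite gt_eqF.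
rewrite big_seq; apply: rpred_sum => C.
move=> /(mem_cliques_seq C fin)[Cmax _].
by rewrite rpredB // hint.
Qed.

Lemma gain_le a b C : maximal_clique E C -> gain a b C <= 2 * M.
Proof.
move=> Cmax; have := hM Cmax (restriction (C := C) b).
have := hM Cmax (restriction (C := C) a).
rewrite /gain !ler_norml => /andP[] + _ => /[swap] /andP[_ +]; lra.
Qed.

Lemma finite_closed_neighborhood i : finite_set [set j | j = i \/ E i j].
Proof.
have -> : [set j | j = i \/ E i j] = [set i] `|` [set j | E i j] by [].
by rewrite finite_setU; split=> //; exact: finite_set1.
Qed.

Lemma clique_sub_neighborhood i C :
  cliques_at E i C -> C `<=` [set j | j = i \/ E i j].
Proof.
move=> [[Cclique _] Ci] j Cj; have [->|ji] := eqVneq j i; first by left.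
by right; apply: Cclique => //; rewrite eq_sym.
Qed.

(** * The weighted potential *)

Section Weights.
Variables (k : V) (d : R).
Hypothesis cliques_le : forall i, (counting (cliques_at E i) <= d%:E)%E.
Hypothesis M0 : 0 <= M.
Hypothesis dM1 : 1 <= 2 * d * M.

Let q : R := 1 - (2 * d * M)^-1.
Let x := distance_weight E k q.

Let inv_gt0 : 0 < (2 * d * M)^-1.
Proof. by rewrite invr_gt0; apply: lt_le_trans dM1. Qed.

Let q0 : 0 <= q.
Proof. by rewrite subr_ge0 invf_le1 // (lt_le_trans ltr01). Qed.

Let q1 : q <= 1.
Proof. by rewrite gerBl ltW. Qed.

Lemma finite_cliques_at i : finite_set (cliques_at E i).
Proof. by have := cliques_le i; rewrite /counting; case: asboolP. Qed.

Variable rep : set V -> V.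
Hypothesis repP : forall i C, cliques_at E i C ->
  C (rep C) /\ forall j, C j -> x j <= x (rep C).

(** The left side is 1 when [k] moves and 0 otherwise, so that adding up over time counts the
    updates of [k]. *)
Lemma weighted_gain_better_response i a b : better_response u i a b ->
  (i == k)%:R <=
    \sum_(C <- cliques_seq i) x (rep C) * gain a b C.
Proof.
move=> br; have fin := finite_cliques_at i.
have g1 := total_gain_ge1 fin br.
have Lat C : C \in cliques_seq i -> cliques_at E i C.
  by move/mem_cliques_seq; apply.
case: eqP => [ik|_].
  apply: le_trans g1 _; rewrite le_eqVlt; apply/orP; left; apply/eqP.
  (* Each of these cliques contains [k], whose weight 1 is the largest possible. *)
  apply: eq_big_seq => C /Lat Ci; suff -> : x (rep C) = 1 by rewrite mul1r.
  apply/eqP; rewrite eq_le distance_weight_le1 //=.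
  rewrite -(distance_weight_center E k q) -/x.
  by apply: (repP Ci).2; rewrite -ik; exact: Ci.2.
have [m mi mmax] := finite_argmax x (finite_closed_neighborhood i)
  (ex_intro _ i (or_introl erefl)).
(* Either [m] is [i] and [q <= 1] suffices, or [m] is a neighbour and the weight drops at most by
   the factor [q] from [m] to [i]. *)
have qm : q * x m <= x i.
  case: mi => [->|im].
    by rewrite ler_piMl // distance_weight_ge0.
  by apply: distance_weight_adj => //; rewrite Esym.
apply: (@weighted_gain_ge0 _ _ _ _ _ (x m) q (2 * M)) => //.
- exact: distance_weight_ge0.
- exact: mulr_ge0.
- have : (size (cliques_seq i))%:R <= d.
    rewrite -lee_fin; apply: le_trans (cliques_le i).
    by apply: size_le_counting; [exact: finmap.fset_uniq|exact: Lat].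
  (* Here [1 - q] is [(2 * d * M)^-1], so the number of cliques being at most [d] is what is
     needed. *)
  move=> sd; rewrite /q opprB addrC subrK.
  rewrite ler_pdivrMr; last exact: lt_le_trans dM1.
  rewrite mul1r mulrCA mulrA; apply: ler_wpM2r => //.
  by apply: ler_wpM2l.
(* The representative weighs at least [x i] since [i] is in [C], and at most [x m] since [C] lies in
   the closed neighbourhood of [i]. *)
- move=> C /Lat Ci; have [Crep Cmax] := repP Ci; apply/andP; split.
    exact: le_trans qm (Cmax _ Ci.2).
  by apply: mmax; apply: clique_sub_neighborhood Crep.
- by move=> C /Lat[Cmax _]; exact: gain_le.
Qed.

End Weights.

(** A nonempty maximal clique lies in the closed neighbourhood of any of its vertices, so it is
    finite and a maximum is attained. The vertex argument supplies a dummy value for all other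
    sets. *)
Lemma exists_heaviest_vertex (x : V -> R) : V ->
  exists rep : set V -> V, forall i C, cliques_at E i C ->
    C (rep C) /\ forall j, C j -> x j <= x (rep C).
Proof.
move=> k; have [|rep repP] := @choice _ _ (fun C v => forall i,
  cliques_at E i C -> C v /\ forall j, C j -> x j <= x v); last first.
  by exists rep => i C; apply: repP.
move=> C.
have [[i Ci]|no] := pselect (exists i, cliques_at E i C); last first.
  by exists k => i Ci; case: no; exists i.
have [||m Cm mmax] := @finite_argmax _ R x C; last by exists m.
- exact: sub_finite_set (clique_sub_neighborhood Ci) (finite_closed_neighborhood i).
- by exists i; exact: Ci.2.
Qed.

(** The finite list [s] lies in a finite prefix of the path, which affects finitely many cliques;
    [F] consists of their heaviest vertices. *)
Lemma update_count_le (T : option nat) (a : nat -> profile S) (k : V) (d : R)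
    (s : seq nat) :
  better_response_path u T a ->
  (forall i, counting (cliques_at E i) <= d%:E)%E ->
  0 <= M -> 1 <= 2 * d * M ->
  uniq s -> (forall t, t \in s -> update_times u T a k t) ->
  exists2 F : seq V, uniq F & (size s)%:R <=
    2 * d * M * \sum_(j <- F) distance_weight E k (1 - (2 * d * M)^-1) j.
Proof.
move=> hpath cd M0 dM1 us sk.
set q := 1 - _; set x := distance_weight E k q.
have q0 : 0 <= q by rewrite subr_ge0 invf_le1 // (lt_le_trans ltr01).
have [rep repP] := exists_heaviest_vertex x k.
have [N Nstep sN] : exists2 N, forall t, (t < N)%N -> is_step T t &
    forall t, t \in s -> (t < N)%N.
  elim: s {us} sk => [|t0 s IH] sk; first by exists 0%N.
  have [|N Nstep sN] := IH; first by move=> t ts; apply: sk; rewrite inE ts orbT.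
  exists (maxn N t0.+1) => t; last first.
    by rewrite inE leq_max => /predU1P[->|/sN->//]; rewrite ltnS leqnn orbT.
  rewrite leq_max => /orP[/Nstep//|tt0].
  have [+ _] := sk t0 (mem_head _ _).
  by rewrite /is_step; case: (T) => // n; apply: leq_ltn_trans.
(* Choose a mover at each time before [N], taking [k] at the times in [s]. *)
have [i iP] : {i : nat -> V & forall t, (t < N)%N ->
    better_response u (i t) (a t) (a t.+1) /\ (t \in s -> i t = k)}.
  apply: (@choice _ _ (fun t v => (t < N)%N ->
    better_response u v (a t) (a t.+1) /\ (t \in s -> v = k))) => t.
  have [ts|ts] := boolP (t \in s); first by exists k => _; split=> //; case: (sk t ts).
  have [tN|tN] := boolP (t < N)%N; last by exists k.
  by have [v vP] := hpath t (Nstep t tN); exists v.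
have fin := finite_cliques_at cd.
pose L t := cliques_seq (i t).
have inL t C : C \in L t <-> cliques_at E (i t) C by exact: mem_cliques_seq.
(* [K] holds all cliques through movers before [N]. It does not depend on [t], so the sums over
   times and cliques can be exchanged; a clique avoiding the mover at [t] contributes 0. *)
pose K := undup (flatten [seq L t | t <- iota 0 N]).
have inK C : C \in K -> exists j, cliques_at E j C.
  by rewrite mem_undup => /flatten_mapP[t _ /inL]; exists (i t).
have sumK t : (t < N)%N ->
    \sum_(C <- K) x (rep C) * gain (a t) (a t.+1) C =
    \sum_(C <- L t) x (rep C) * gain (a t) (a t.+1) C.
  move=> tN; rewrite (bigID (fun C => C \in L t)) /= [X in _ + X]big1_seq ?addr0.
    rewrite -big_filter; apply: perm_big; apply: uniq_perm.
    - by rewrite filter_uniq ?undup_uniq.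
    - exact: finmap.fset_uniq.
    move=> C; rewrite mem_filter andb_idr // => CL.
    by rewrite mem_undup; apply/flatten_mapP; exists t; rewrite // mem_iota.
  move=> C /andP[/negP CL /inK[j [Cmax _]]].
  rewrite (@gain_eq0 (i t)) ?mulr0 //; first exact: (iP t tN).1.
  by move=> Ci; apply: CL; apply/inL.
exists (undup (map rep K)); first exact: undup_uniq.
apply: le_trans (_ : \sum_(0 <= t < N)
    \sum_(C <- K) x (rep C) * gain (a t) (a t.+1) C <= _).
  apply: le_trans (_ : \sum_(0 <= t < N) (t \in s)%:R <= _).
    rewrite -natr_sum ler_nat -big_mkcond /= sum1_count -size_filter.
    apply: uniq_leq_size => // t ts.
    by rewrite mem_filter ts mem_index_iota sN.
  apply: ler_sum_nat => t /= tN; rewrite sumK //.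
  have [br ik] := iP t tN.
  apply: le_trans (weighted_gain_better_response cd M0 dM1 repP br).
  by case: (t \in s) ik => [->//|_]; rewrite ?eqxx ?ler0n.
rewrite exchange_big /=.
(* For a fixed clique the gains telescope to the potential at time [N] minus that at time 0. *)
apply: le_trans (_ : \sum_(C <- K) x (rep C) * (2 * M) <= _).
  rewrite big_seq [leRHS]big_seq; apply: ler_sum => C /inK[j [Cmax _]].
  rewrite -mulr_sumr; apply: ler_wpM2l; first exact: distance_weight_ge0.
  rewrite (telescope_sumr (fun t => Phi (restriction (C := C) (a t)))) //.
  exact: gain_le.
rewrite -mulr_suml (mulrC 2 d) -(mulrA d) (mulrC d) -mulrA [leLHS]mulrC.
apply: ler_wpM2l; first exact: mulr_ge0.
(* The cliques represented by [j] all contain [j], hence number at most [d]. *)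
apply: sum_fibers_le => j; first exact: distance_weight_ge0.
rewrite -lee_fin; apply: le_trans (cd j); rewrite -size_filter.
apply: size_le_counting; first by rewrite filter_uniq ?undup_uniq.
move=> C; rewrite mem_filter => /andP[/eqP <- /inK[v Cv]].
by split; [exact: Cv.1|have [] := repP v C Cv].
Qed.
End Dynamics.

(** * The bound in the extended reals *)

Local Open Scope ereal_scope.

Theorem theorem6p3 (R : realType) (V : countType) (E : rel V)
    (Vinf : infinite_set [set: V])
    (Esym : symmetric E) (Eirr : irreflexive E) (Elf : locally_finite E)
    (S : V -> finType) (u : utilities S R) (Phi : local_potentials S R) (M : R)
    (hgame : generalized_potential_game E u Phi)
    (hM : bounded_potentials E M Phi)
    (hint : integral_potentials E Phi)
    (D : \bar R) (hD : D = clique_degree E R)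
    (hDM : M = 0%R \/ 1 <= 2%:E * D * M%:E)
    (T : option nat) (a : nat -> profile S) (hpath : better_response_path u T a)
    (k : V) :
  counting (update_times u T a k) <=
    2%:E * D * M%:E *
      \sum_(0 <= r <oo)
        (1 - (2%:E * D * M%:E)^-1) ^+ r * counting (sphere E k r).
Proof.
apply: counting_le => s us sk.
have clD i : counting (cliques_at E i) <= D.
  by rewrite hD; apply: ereal_sup_ubound; exists i.
have D0 : 0 <= D by apply: le_trans (clD k); apply: (@size_le_counting _ R _ [::]).
(* If [M = 0], the right side is 0 even for infinite [D], as [+oo * 0 = 0]; the potentials vanish on
   maximal cliques, so [k] can never improve. *)
have [M_eq0|M0] := eqVneq M 0%R.
  case: s sk {us} => [|t s] sk; first by rewrite M_eq0 mule0 mul0e.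
  have [_ /(better_response_utility_gain hgame)] := sk t (mem_head _ _).
  have Phi0 b : clique_utilities E Phi k b = 0%R.
    rewrite /clique_utilities fsbig1 // => C [Cmax _].
    apply/eqP; rewrite -normr_le0 -[leRHS]M_eq0; exact: hM.
  by rewrite !Phi0 subrr ltxx.
have {}hDM : 1 <= 2%:E * D * M%:E by case: hDM M0 => // ->; rewrite eqxx.
have D20 : 0 <= 2%:E * D by apply: mule_ge0; rewrite ?lee_fin.
have {}M0 : (0 < M)%R.
  rewrite ltNge; apply/negP => Mle0; have := le_trans hDM (mule_ge0_le0 D20 _).
  by rewrite lee_fin => /(_ Mle0); rewrite lee_fin ler10.
case: D hD clD D0 D20 hDM => [d| |] // hD clD D0 D20 hDM.
- rewrite -!EFinM in hDM *; rewrite lee_fin in hDM.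
  have c0 : (0 < 2 * d * M)%R by apply: lt_le_trans hDM.
  have q0 : (0 <= 1 - (2 * d * M)^-1)%R by rewrite subr_ge0 invf_le1.
  have q1 : (1 - (2 * d * M)^-1 <= 1)%R by rewrite gerBl invr_ge0 ltW.
  have [F uF sF] := update_count_le Esym Elf hgame hM hint hpath clD (ltW M0)
    hDM us sk.
  rewrite inver gt_eqF // -EFinB.
  move: sF; rewrite -lee_fin => /le_trans; apply; rewrite [leLHS]EFinM.
  apply: lee_wpmul2l; first by rewrite lee_fin ltW.
  under eq_eseriesr do rewrite -EFin_expe.
  exact: sum_distance_weight_le.
(* For infinite [D] the ratio is [1 - 0 = 1]. The sphere of radius 0 contains [k], so the series is
   positive and the right side is [+oo]. *)
- have -> : 2%:E * +oo * M%:E = +oo :> \bar R.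
    by rewrite gt0_muley ?lte_fin // gt0_mulye ?lte_fin.
  rewrite invey sube0 gt0_mulye ?leey //.
  have one_expe n : (1 : \bar R) ^+ n = 1 by rewrite -EFin_expe expr1n.
  under eq_eseriesr do rewrite one_expe mul1e.
  have cge0 r : 0 <= counting (sphere E k r) :> \bar R.
    exact: (@size_le_counting _ R _ [::]).
  apply: lt_le_trans (@nneseries_lim_ge R _ xpredT 0 1 _); last by move=> *.
  rewrite big_nat1; apply: lt_le_trans (@size_le_counting _ R _ [:: k] _ _) => //.
  by move=> j; rewrite inE => /eqP ->; exact: sphere0.
Qed.
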